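(* For every integer $n\ge 1$, the polynomials $P_n$ attached to the pattern $1324$ and the inversion number satisfy $$P_{n}(t,q; X_{n},Y_{n}) = \sum_{i=1}^{n} q^{i-1}\, x_{i,i}^{n-i}\, x_{i,i+1}^{n-i-1} \cdots x_{i,n-1}^{1} \cdot P_{n-1}\bigl(t,q;\; R_{2}(X_{n},Y_{n},i),\; R_{1}(Y_{n},i)\bigr),$$ where the monomial in the $x$ variables is $\prod_{j=i}^{n-1} x_{i,j}^{\,n-j}$ (empty product $=1$ when $i=n$).
   Context: $\mathcal{S}_n$ is the set of permutations $\pi=\pi_1\ldots\pi_n$ of $\{1,\ldots,n\}$. $\mathrm{inv}(\pi)$ is the number of pairs $1\le a<b\le n$ with $\pi_a>\pi_b$. $N_{1324}(\pi)$ is the number of occurrences of the pattern $1324$ in $\pi$, i.e. the number of index quadruples $1\le a<b<c<d\le n$ with $\pi_a<\pi_c<\pi_b<\pi_d$. Let $t$, $q$, $x_{i,j}$ ($1\le i\le j\le n$) and $y_{i,j}$ ($1\le j\le i\le n$) be commuting variables. The weight of $\pi\in\mathcal{S}_n$ is $$\mathrm{weight}(\pi) := t^{N_{1324}(\pi)} \prod_{1\le i\le j\le n} x_{i,j}^{\#\{(a,b)\,:\, \pi_a<\pi_b,\ \pi_a=i,\ \pi_b>j\}} \cdot \prod_{1\le j\le i\le n} y_{i,j}^{\#\{(a,b,c)\,:\, \pi_b<\pi_a<\pi_c,\ \pi_a=i,\ \pi_b\ge j\}},$$ where always $1\le a<b<c\le n$ (respectively $1\le a<b\le n$ for pairs).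 $X_n=[x_{i,j}]$ and $Y_n=[y_{i,j}]$ are $n\times n$ matrices of variables; the entries of $X_n$ below the diagonal and the entries of $Y_n$ above the diagonal are disregarded (they play no role), and the same convention applies to all smaller matrices. Define $$P_n(t,q;X_n,Y_n):=\sum_{\pi\in\mathcal{S}_n}q^{\mathrm{inv}(\pi)}\,\mathrm{weight}(\pi).$$ For $n\times n$ matrices $A,B$ with entries in a commutative ring containing $t,q$, $P_n(t,q;A,B)$ denotes the result of substituting $x_{i,j}=A_{i,j}$ for $i\le j$ and $y_{i,j}=B_{i,j}$ for $j\le i$. By convention $P_0=1$. Operator $R_1$: for an $n\times n$ matrix $Y_n=[y_{k,l}]$ and $1\le i<n$, $R_1(Y_n,i)$ is the $(n-1)\times(n-1)$ matrix obtained by deleting the $i$-th row and replacing the $i$-th and $(i+1)$-th columns by a single column, whose entry in the row coming from row $k$ ($k\ne i$) is $t\,y_{k,i}\,y_{k,i+1}$. If $i=n$, $R_1(Y_n,n)$ is obtained by deleting the $n$-th row and $n$-th column. Operator $R_2$: for $n\times n$ matrices $X_n=[x_{k,l}]$, $Y_n=[y_{k,l}]$ and $1<i\le n$, $R_2(X_n,Y_n,i)$ is the $(n-1)\times(n-1)$ matrix obtained from $X_n$ by deleting the $i$-th row and replacing the $(i-1)$-th and $i$-th columns by a single column, whose entry in the row coming from row $k$ ($k\ne i$) is $$w_k:=\begin{cases} y_{i,1}y_{i,2}\cdots y_{i,k}\cdot x_{k,i-1}\cdot x_{k,i} & k\le i-1,\\ 0 & k>i-1.\end{cases}$$ If $i=1$,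 $R_2(X_n,Y_n,1)$ is obtained from $X_n$ by deleting the first row and first column. *)

(* Defs.v *)
From HB Require Import structures.
From mathcomp Require Import all_boot all_order all_fingroup all_algebra.

Set Implicit Arguments.
Unset Strict Implicit.
Unset Printing Implicit Defensive.

Import GRing.Theory.

Local Open Scope ring_scope.

(* MathComp world.  All indices are 0-based: the ordinal i : 'I_n stands for
   the position, letter, row or column i + 1, and s a is the letter of the
   permutation s at position a. *)

Definition inv_num (n : nat) (s : 'S_n) : nat :=
  #|[set p : 'I_n * 'I_n | (p.1 < p.2)%N && (s p.2 < s p.1)%N]|.

Definition occ1324 (n : nat) (s : 'S_n) : nat :=
  #|[set p : 'I_n * 'I_n * 'I_n * 'I_n |
      let: (a, b, c, d) := p in
      [&& (a < b)%N, (b < c)%N, (c < d)%N,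
          (s a < s c)%N, (s c < s b)%N & (s b < s d)%N]]|.

Definition xexp (n : nat) (s : 'S_n) (i j : 'I_n) : nat :=
  #|[set p : 'I_n * 'I_n |
      let: (a, b) := p in
      [&& (a < b)%N, (s a < s b)%N, s a == i & (j < s b)%N]]|.

Definition yexp (n : nat) (s : 'S_n) (i j : 'I_n) : nat :=
  #|[set p : 'I_n * 'I_n * 'I_n |
      let: (a, b, c) := p in
      [&& (a < b)%N, (b < c)%N, (s b < s a)%N, (s a < s c)%N,
          s a == i & (j <= s b)%N]]|.

(* The variables t, q, x_{i,j}, y_{i,j} are represented by arbitrary elements
   of an arbitrary commutative ring, so that the substitutions P(t, q; A, B)
   are plain applications; identities between polynomials in formal variables
   are the instances where R is a polynomial ring and the arguments are its
   variables. *)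

Definition weight1324 (R : comPzRingType) (n : nat) (t : R) (X Y : 'M[R]_n)
    (s : 'S_n) : R :=
  t ^+ occ1324 s
  * (\prod_(i < n) \prod_(j < n | (i <= j)%N) X i j ^+ xexp s i j)
  * (\prod_(i < n) \prod_(j < n | (j <= i)%N) Y i j ^+ yexp s i j).

Definition P1324 (R : comPzRingType) (n : nat) (t q : R) (X Y : 'M[R]_n) : R :=
  \sum_(s : 'S_n) q ^+ inv_num s * weight1324 t X Y s.

Lemma P1324_0 (R : comPzRingType) (t q : R) (X Y : 'M[R]_0) :
  P1324 t q X Y = 1.
Proof.
have c0 (T : finType) (f : T -> 'I_0) (A : {set T}) : #|A| = 0%N.
  by apply: eq_card0 => x; case: (f x).
rewrite /P1324 (big_pred1 1%g) => [|s]; last first.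
  by symmetry; apply/eqP/permP; case.
rewrite /weight1324 !big_ord0 /inv_num /occ1324.
by rewrite (c0 _ (fun p => p.1)) (c0 _ (fun p => p.2)) !expr0 !mulr1.
Qed.

(* The new row k comes from the old row lift i k.  The columns i and i + 1 of Y
   merge into the new column l = i, for which lift i l is the old column i + 1;
   any other new column l comes from the old column lift i l.  If i is the last
   index then l < i always, so that row i and column i are simply deleted. *)
Definition R1 (R : comPzRingType) (n : nat) (t : R) (Y : 'M[R]_n.+1)
    (i : 'I_n.+1) : 'M[R]_n :=
  \matrix_(k < n, l < n)
    if l == i :> nat
    then t * Y (lift i k) i * Y (lift i k) (lift i l)
    else Y (lift i k) (lift i l).

(* The columns i - 1 and i of X merge into the new column l = i - 1, for which
   lift i l is the old column i - 1; any other new column l comes from the old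
   column lift i l.  If i = 0 the test l.+1 == i always fails, so that row 0 and
   column 0 are simply deleted. *)
Definition R2 (R : comPzRingType) (n : nat) (X Y : 'M[R]_n.+1)
    (i : 'I_n.+1) : 'M[R]_n :=
  \matrix_(k < n, l < n)
    if l.+1 == i :> nat
    then if (lift i k < i)%N
         then (\prod_(m < n.+1 | (m <= lift i k)%N) Y i m)
              * X (lift i k) (lift i l) * X (lift i k) i
         else 0
    else X (lift i k) (lift i l).

(* Main.v *)
Require Import Defs.
From HB Require Import structures.
From mathcomp Require Import all_boot all_order all_fingroup all_algebra.

Set Implicit Arguments.
Unset Strict Implicit.
Unset Printing Implicit Defensive.

Import GRing.Theory.

Local Open Scope ring_scope.

(** The recurrence classifies the permutations by their first letter [i]:
deleting it and standardizing the remaining letters is a bijection onto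
['S_n], whose inverse is [fun s => lift_perm ord0 i s].  The work is to see how
the weight changes.

Instead of collecting exponents, the weight is written as a product over the
occurrences of patterns, every occurrence contributing a factor that depends on
letters only:
- an ascent pair with letters [k < m] contributes the product of the [X k j]
  with [k <= j < m] ([prod_xexp]);
- an occurrence of 213 whose 2 and 1 are [k] and [m] contributes the product of
  the [Y k j] with [j <= m] ([prod_yexp]);
- an inversion contributes [q], an occurrence of 1324 contributes [t].

An occurrence of one of these patterns in [lift_perm ord0 i s] either avoids the
first position, and then it is an occurrence in [s] with letters renamed by
[lift i], or starts at it.  The occurrences that start there become data on [s]
as follows.
- The inversions and the ascents with first letter [i] are determined by the
  other letter alone; they give [q ^+ i] and the monomial in row [i] of [X].
- An occurrence of 213 in which [i] is the 2 is an ascent pair of [s] from a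
  letter below [i] to a letter above [i] ([prod_213_first]).
- An occurrence of 1324 in which [i] is the 1 is an occurrence of 213 in [s] all
  of whose letters are above [i] ([prod_1324_first]).

Hence every ascent of [s] that jumps over [i] carries the additional factor
[\prod_(j <= k) Y i j], and every 213 of [s] lying above [i] carries an
additional [t].  These ascents are exactly those whose range of columns contains
the merged column [i - 1] of [R2], and these 213 are exactly those whose range of
columns contains the merged column [i] of [R1]; so the additional factors can be
stored in the entries of those columns, together with the two old entries being
merged.  This is what [prod_R1] and [prod_R2] say, and it is the reason for the
shape of both operators. *)

(** * Order relations between lifted ordinals *)

Lemma ltn_lift2 n (i : 'I_n.+1) (k m : 'I_n) :
  (lift i k < lift i m)%N = (k < m)%N.
Proof. by rewrite !ltnNge leq_bump2. Qed.

Lemma leq_lift2 n (i : 'I_n.+1) (k m : 'I_n) :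
  (lift i k <= lift i m)%N = (k <= m)%N.
Proof. exact: leq_bump2. Qed.

Lemma ltn_lift_pivot n (i : 'I_n.+1) (k : 'I_n) : (lift i k < i)%N = (k < i)%N.
Proof.
rewrite /= /bump; case: (leqP i k) => [le_ik | lt_ki]; last by rewrite add0n.
by apply/negbTE; rewrite -leqNgt (leq_trans le_ik) // leqW.
Qed.

Lemma ltn_pivot_lift n (i : 'I_n.+1) (k : 'I_n) : (i < lift i k)%N = (i <= k)%N.
Proof.
by rewrite ltn_neqAle neq_lift /= leqNgt ltn_lift_pivot -leqNgt.
Qed.

Lemma leq_lift_pivot n (i : 'I_n.+1) (k : 'I_n) : (lift i k <= i)%N = (k < i)%N.
Proof. by rewrite leqNgt ltn_pivot_lift -ltnNge. Qed.

Lemma leq_pivot_lift n (i : 'I_n.+1) (k : 'I_n) : (i <= lift i k)%N = (i <= k)%N.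
Proof. by rewrite leqNgt ltn_lift_pivot -leqNgt. Qed.

(** * Permutations with a given first letter *)

(** Surjectivity comes from counting: both sides have [n.+1`!] elements. *)
Lemma lift_perm_pair_bij n :
  bijective (fun p : 'I_n.+1 * 'S_n => lift_perm ord0 p.1 p.2).
Proof.
apply: inj_card_bij => [[i s] [j u] /= eq_su|]; last first.
  by rewrite card_prod card_ord !card_Sn factS.
have eq_ij : i = j.
  by rewrite -(lift_perm_id ord0 i s) eq_su lift_perm_id.
rewrite eq_ij in eq_su *; congr (_, _); apply/permP => k.
by apply: (@lift_inj _ j); rewrite -!(lift_perm_lift ord0) eq_su.
Qed.

Section Products.

Variable R : comPzRingType.

(** * Products over ordinals *)

(** Isolates the index [i]; it is applied to positions with [i] the first one,
    and to letters and columns with [i] the first letter. *)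
Lemma prod_ord_lift n (i : 'I_n.+1) (P : pred 'I_n.+1) (F : 'I_n.+1 -> R) :
  \prod_(j < n.+1 | P j) F j =
  (if P i then F i else 1)
  * \prod_(l < n | P (lift i l)) F (lift i l).
Proof.
case Pi: (P i); first by rewrite (bigD1_ord i).
rewrite mul1r big_mkcond (bigD1_ord i) //= Pi mul1r.
by rewrite [RHS]big_mkcond.
Qed.

Lemma prod_single_index n (P : pred nat) (v : nat) (c : R) :
  \prod_(l < n | P l) (if l == v :> nat then c else 1) =
  if (v < n)%N && P v then c else 1.
Proof.
rewrite -big_mkcondr /=; case: (ltnP v n) => /= [lt_vn | le_nv].
  case: ifP => Pv; last first.
    by rewrite big_pred0 // => l; case: eqP => [->|]; rewrite ?Pv ?andbF.
  rewrite (big_pred1 (Ordinal lt_vn)) // => l /=.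
  by rewrite -val_eqE /=; case: eqP => [->|]; rewrite ?Pv ?andbF.
by rewrite big_pred0 // => l; rewrite andbC ltn_eqF // (leq_trans _ le_nv).
Qed.

(** Double counting: a power whose exponent counts occurrences [p] is a product
    over these occurrences, and the order of multiplication can be exchanged.
    Here [g p] is the letter that selects the row of the matrix, [h p] the
    condition on the column, and [D] the triangle of the matrix in use. *)
Lemma prod_expr_card n (T : finType) (A : pred T) (g : T -> 'I_n)
    (h Q : T -> 'I_n -> bool) (D : rel 'I_n) (X : 'M[R]_n)
    (e : 'I_n -> 'I_n -> nat) :
  (forall i j, e i j = #|[set p | [&& A p, g p == i & h p j]]|) ->
  (forall p j, A p -> D (g p) j && h p j = Q p j) ->
  \prod_(i < n) \prod_(j < n | D i j) X i j ^+ e i j =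
  \prod_(p | A p) \prod_(j < n | Q p j) X (g p) j.
Proof.
move=> eE QE.
transitivity (\prod_(i < n) \prod_(p | A p && (g p == i))
                \prod_(j < n | Q p j) X i j).
  apply: eq_bigr => i _.
  transitivity (\prod_(j < n | D i j)
      \prod_(p in [set p | [&& A p, g p == i & h p j]]) X i j).
    by apply: eq_bigr => j _; rewrite eE prodr_const.
  rewrite (exchange_big_dep (fun p => A p && (g p == i))) /=; last first.
    by move=> j p _; rewrite inE => /and3P[-> ->].
  apply: eq_bigr => p /andP[Ap /eqP gp]; apply: eq_bigl => j.
  by rewrite inE -QE // gp Ap eqxx.
rewrite (exchange_big_dep A) /=; last by move=> i p _ /andP[].
apply: eq_bigr => p Ap.
by rewrite (big_pred1 (g p)) // => i; rewrite Ap eq_sym.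
Qed.

(** * The weight as a product over occurrences of patterns *)

Definition prod_asc n (s : 'S_n) (F : 'I_n -> 'I_n -> R) : R :=
  \prod_(a < n) \prod_(b < n | (a < b)%N && (s a < s b)%N) F (s a) (s b).

Definition prod_213 n (s : 'S_n) (F : 'I_n -> 'I_n -> R) : R :=
  \prod_(a < n) \prod_(b < n | (a < b)%N && (s b < s a)%N)
     \prod_(c < n | (b < c)%N && (s a < s c)%N) F (s a) (s b).

(** The inequalities are distributed so that, for a fixed first position [a], the
    conditions on [b], [c], [d] are those of [prod_213] restricted to letters
    above [s a]. *)
Definition prod_1324 n (s : 'S_n) (t : R) : R :=
  \prod_(a < n) \prod_(b < n | (a < b)%N && (s a < s b)%N)
     \prod_(c < n | (b < c)%N && ((s c < s b)%N && (s a < s c)%N))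
     \prod_(d < n | (c < d)%N && (s b < s d)%N) t.

Definition prod_inv n (s : 'S_n) (q : R) : R :=
  \prod_(a < n) \prod_(b < n | (a < b)%N && (s b < s a)%N) q.

Lemma eq_prod_asc n (s : 'S_n) F G :
  F =2 G -> prod_asc s F = prod_asc s G.
Proof. by move=> FG; do 2![apply: eq_bigr => ? _]. Qed.

Lemma eq_prod_213 n (s : 'S_n) F G :
  F =2 G -> prod_213 s F = prod_213 s G.
Proof. by move=> FG; do 3![apply: eq_bigr => ? _]. Qed.

Lemma prod_ascM n (s : 'S_n) F G :
  prod_asc s (fun k m => F k m * G k m) = prod_asc s F * prod_asc s G.
Proof.
rewrite -big_split; apply: eq_bigr => a _ /=.
by rewrite -big_split.
Qed.

Lemma prod_213M n (s : 'S_n) F G :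
  prod_213 s (fun k m => F k m * G k m) = prod_213 s F * prod_213 s G.
Proof.
rewrite -big_split; apply: eq_bigr => a _ /=.
rewrite -big_split; apply: eq_bigr => b _ /=.
by rewrite -big_split.
Qed.

Lemma expr_inv_num n (s : 'S_n) (q : R) : q ^+ inv_num s = prod_inv s q.
Proof.
rewrite -prodr_const /prod_inv pair_big_dep /=.
by apply: eq_bigl => p; rewrite inE.
Qed.

Lemma expr_occ1324 n (s : 'S_n) (t : R) : t ^+ occ1324 s = prod_1324 s t.
Proof.
rewrite -prodr_const /prod_1324 !pair_big_dep /=.
apply: eq_bigl => [[[[a b] c] d]]; rewrite inE /=.
case: (ltnP (s a) (s c)) => lac; rewrite ?andbF //=.
case: (ltnP (s c) (s b)) => lcb; rewrite ?andbF //=.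
by rewrite (ltn_trans lac lcb); case: (a < b)%N; case: (b < c)%N.
Qed.

Lemma prod_xexp n (X : 'M[R]_n) (s : 'S_n) :
  \prod_(i < n) \prod_(j < n | (i <= j)%N) X i j ^+ xexp s i j =
  prod_asc s (fun k m => \prod_(j < n | (k <= j < m)%N) X k j).
Proof.
rewrite (@prod_expr_card n _
  (fun p : 'I_n * 'I_n => (p.1 < p.2)%N && (s p.1 < s p.2)%N)
  (fun p => s p.1) (fun p j => j < s p.2)%N
  (fun p j => s p.1 <= j < s p.2)%N) //.
  by rewrite /prod_asc [RHS]pair_big_dep.
by move=> i j; congr #|pred_of_set _|; apply/setP => -[a b]; rewrite !inE andbA.
Qed.

Lemma prod_yexp n (Y : 'M[R]_n) (s : 'S_n) :
  \prod_(i < n) \prod_(j < n | (j <= i)%N) Y i j ^+ yexp s i j =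
  prod_213 s (fun k m => \prod_(j < n | (j <= m)%N) Y k j).
Proof.
rewrite (@prod_expr_card n _ (fun p : 'I_n * 'I_n * 'I_n =>
    ((p.1.1 < p.1.2)%N && (s p.1.2 < s p.1.1)%N)
      && ((p.1.2 < p.2)%N && (s p.1.1 < s p.2)%N))
  (fun p => s p.1.1) (fun p j => j <= s p.1.2)%N
  (fun p j => j <= s p.1.2)%N).
- by rewrite /prod_213 [RHS]pair_big_dep [RHS]pair_big_dep.
- move=> i j; congr #|pred_of_set _|; apply/setP => -[[a b] c].
  by rewrite !inE /= -!andbA; do !bool_congr.
- move=> [[a b] c] j /= /andP[/andP[_ ltba] _].
  rewrite andbC; case: leqP => //= lejb.
  exact: leq_trans lejb (ltnW ltba).
Qed.

Lemma P1324_prod n (t q : R) (X Y : 'M[R]_n) :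
  P1324 t q X Y =
  \sum_(s : 'S_n) prod_inv s q *
    (prod_1324 s t
     * prod_asc s (fun k m => \prod_(j < n | (k <= j < m)%N) X k j)
     * prod_213 s (fun k m => \prod_(j < n | (j <= m)%N) Y k j)).
Proof.
apply: eq_bigr => s _.
by rewrite /weight1324 expr_inv_num expr_occ1324 prod_xexp prod_yexp.
Qed.

Lemma sum_by_first_letter n (f : 'S_n.+1 -> R) :
  \sum_(s : 'S_n.+1) f s =
  \sum_(i < n.+1) \sum_(s : 'S_n) f (lift_perm ord0 i s).
Proof.
rewrite (reindex _ (onW_bij _ (lift_perm_pair_bij n))) /=.
by rewrite [RHS]pair_bigA.
Qed.

(** * Removing the first letter *)

Section FirstLetter.

Variables (n : nat) (i : 'I_n.+1) (s : 'S_n).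
Let s' := lift_perm ord0 i s.

Lemma prod_after_first (P : pred 'I_n.+1) (F : 'I_n.+1 -> R) :
  \prod_(b < n.+1 | ((ord0 : 'I_n.+1) < b)%N && P (s' b)) F (s' b) =
  \prod_(b < n | P (lift i (s b))) F (lift i (s b)).
Proof.
rewrite (prod_ord_lift ord0) /= mul1r.
by apply: eq_big => [b | b _]; rewrite lift_perm_lift.
Qed.

Lemma prod_after_lift (a : 'I_n) (P : pred 'I_n.+1) (F : 'I_n.+1 -> R) :
  \prod_(b < n.+1 | (lift ord0 a < b)%N && P (s' b)) F b =
  \prod_(b < n | (a < b)%N && P (lift i (s b))) F (lift ord0 b).
Proof.
rewrite (prod_ord_lift ord0) /= mul1r.
by apply: eq_bigl => b; rewrite lift_perm_lift.
Qed.

(** A factor that depends on [b] only through its letter may be indexed by the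
    letters, because [s] is a bijection. *)
Lemma prod_letters_after_first (P : pred 'I_n.+1) (F : 'I_n.+1 -> R) :
  \prod_(b < n.+1 | ((ord0 : 'I_n.+1) < b)%N && P (s' b)) F (s' b) =
  \prod_(m < n | P (lift i m)) F (lift i m).
Proof. by rewrite prod_after_first [RHS](reindex_inj (@perm_inj _ s)). Qed.

(** An inversion that starts at the first position is determined by its smaller
    letter, one of the [i] letters below [i]. *)
Lemma prod_inv_first (q : R) : prod_inv s' q = q ^+ i * prod_inv s q.
Proof.
rewrite {1}/prod_inv (prod_ord_lift ord0) /= lift_perm_id; congr (_ * _).
  rewrite (prod_letters_after_first (fun v => v < i)%N (fun=> q)).
  under eq_bigl => m do rewrite ltn_lift_pivot.
  have le_in : (i <= n)%N by rewrite -ltnS.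
  by rewrite (big_ord_narrow le_in) prodr_const card_ord.
apply: eq_bigr => a _; rewrite lift_perm_lift.
rewrite (prod_after_lift a (fun v => v < lift i (s a))%N).
by apply: eq_bigl => b; rewrite ltn_lift2.
Qed.

Lemma prod_asc_first (F : 'I_n.+1 -> 'I_n.+1 -> R) :
  prod_asc s' F =
  (\prod_(v < n.+1 | (i < v)%N) F i v)
  * prod_asc s (fun k m => F (lift i k) (lift i m)).
Proof.
rewrite {1}/prod_asc (prod_ord_lift ord0) /= lift_perm_id; congr (_ * _).
  rewrite (prod_letters_after_first (fun v => i < v)%N (F i)).
  by rewrite [RHS](prod_ord_lift i) ltnn mul1r.
apply: eq_bigr => a _; rewrite lift_perm_lift.
rewrite (prod_after_lift a (fun v => lift i (s a) < v)%N).
by apply: eq_big => b; rewrite ?lift_perm_lift ?ltn_lift2.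
Qed.

(** When the first letter [i] plays the 2, the 1 and the 3 form an ascent pair of
    [s] that jumps over [i]; this is where the [y] variables of row [i] enter
    the [x] matrix of the smaller instance. *)
Lemma prod_213_first (F : 'I_n.+1 -> 'I_n.+1 -> R) :
  prod_213 s' F =
  prod_asc s (fun k m => if (k < i <= m)%N then F i (lift i k) else 1)
  * prod_213 s (fun k m => F (lift i k) (lift i m)).
Proof.
rewrite {1}/prod_213 (prod_ord_lift ord0) /= lift_perm_id; congr (_ * _).
  rewrite (prod_ord_lift ord0) /= mul1r big_mkcond.
  apply: eq_bigr => b _; rewrite lift_perm_lift ltn_lift_pivot.
  rewrite (prod_after_lift b (fun v => i < v)%N).
  case: (ltnP (s b) i) => [lt_bi | _] /=; last by rewrite big1.
  rewrite big_mkcond [RHS]big_mkcond; apply: eq_bigr => c _.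
  rewrite ltn_pivot_lift; case: (leqP i (s c)) => le_ic.
    by rewrite (leq_trans lt_bi le_ic).
  by rewrite andbF if_same.
apply: eq_bigr => a _; rewrite lift_perm_lift.
rewrite (prod_after_lift a (fun v => v < lift i (s a))%N).
apply: eq_big => b; rewrite ?ltn_lift2 // => _.
rewrite (prod_after_lift b (fun v => lift i (s a) < v)%N) lift_perm_lift.
by apply: eq_bigl => c; rewrite ltn_lift2.
Qed.

(** When the first letter [i] plays the 1, the other three letters form a 213 of
    [s]; it lies above [i] as soon as its smallest letter does. *)
Lemma prod_1324_first (t : R) :
  prod_1324 s' t =
  prod_213 s (fun k m => if (i <= m)%N then t else 1) * prod_1324 s t.
Proof.
rewrite {1}/prod_1324 (prod_ord_lift ord0) /= lift_perm_id; congr (_ * _).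
  rewrite (prod_ord_lift ord0) /= mul1r big_mkcond.
  apply: eq_bigr => b _; rewrite lift_perm_lift ltn_pivot_lift.
  rewrite (prod_after_lift b (fun v => (v < lift i (s b)) && (i < v))%N).
  case: (leqP i (s b)) => [le_ib | lt_bi].
    rewrite big_mkcond [RHS]big_mkcond; apply: eq_bigr => c _.
    rewrite ltn_lift2 ltn_pivot_lift.
    rewrite (prod_after_lift c (fun v => lift i (s b) < v)%N).
    case: (b < c)%N; case: (s c < s b)%N => //=.
    case: (leqP i (s c)) => _; last by rewrite big1.
    by apply: eq_bigl => d; rewrite ltn_lift2.
  rewrite big1 // => c /andP[_ lt_cb]; rewrite big1 // => d _.
  by rewrite leqNgt (ltn_trans lt_cb lt_bi).
apply: eq_bigr => a _; rewrite lift_perm_lift.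
rewrite (prod_after_lift a (fun v => lift i (s a) < v)%N).
apply: eq_big => b; rewrite ?ltn_lift2 // => _; rewrite lift_perm_lift.
rewrite (prod_after_lift b
  (fun v => (v < lift i (s b)) && (lift i (s a) < v))%N).
apply: eq_big => c; rewrite ?ltn_lift2 // => _.
rewrite (prod_after_lift c (fun v => lift i (s b) < v)%N).
by apply: eq_bigl => d; rewrite ltn_lift2.
Qed.

End FirstLetter.

(** * The contracted matrices *)

(** The variable [X i j] occurs once for each of the [n - j] letters above [j]. *)
Lemma prod_x_first n (i : 'I_n.+1) (X : 'M[R]_n.+1) :
  \prod_(v < n.+1 | (i < v)%N) \prod_(j < n.+1 | (i <= j < v)%N) X i j =
  \prod_(j < n.+1 | (i <= j < n)%N) X i j ^+ (n - j).
Proof.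
rewrite (exchange_big_dep (fun j : 'I_n.+1 => i <= j < n)%N) /=; last first.
  move=> v j _ /andP[-> lt_jv] /=.
  by rewrite (leq_trans lt_jv) // -ltnS.
apply: eq_bigr => j /andP[le_ij _].
rewrite -[(n - j)%N]subSS -prodr_const_nat big_geq_mkord /=.
apply: eq_bigl => v; rewrite le_ij /=.
by case: (ltnP j v) => [/(leq_ltn_trans le_ij)->|]; rewrite ?andbF.
Qed.

(** The range [l <= m] contains the merged column [i] exactly when [i <= m], and
    in this case the extra [t] and the extra entry of column [i] appear. *)
Lemma prod_R1 n (t : R) (Y : 'M[R]_n.+1) (i : 'I_n.+1) (k m : 'I_n) :
  \prod_(l < n | (l <= m)%N) R1 t Y i k l =
  (if (i <= m)%N then t else 1)
  * \prod_(j < n.+1 | (j <= lift i m)%N) Y (lift i k) j.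
Proof.
rewrite [in RHS](prod_ord_lift i) leq_pivot_lift.
under [in RHS]eq_bigl => l do rewrite leq_lift2.
transitivity ((\prod_(l < n | (l <= m)%N)
    if l == i :> nat then t * Y (lift i k) i else 1)
    * \prod_(l < n | (l <= m)%N) Y (lift i k) (lift i l)).
  rewrite -big_split /=; apply: eq_bigr => l _; rewrite mxE.
  by case: eqP; rewrite ?mul1r.
rewrite (prod_single_index n (fun l => l <= m)%N) /= mulrA; congr (_ * _).
case: (leqP i m) => [le_im | _]; last by rewrite andbF mulr1.
by rewrite (leq_ltn_trans le_im).
Qed.

(** The range [k <= l < m] contains the merged column [i - 1] exactly when
    [k < i <= m].  In particular the zero entries of that column, which lie in
    the rows [k >= i], are never met. *)
Lemma prod_R2 n (X Y : 'M[R]_n.+1) (i : 'I_n.+1) (k m : 'I_n) :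
  \prod_(l < n | (k <= l < m)%N) R2 X Y i k l =
  (if (k < i <= m)%N then \prod_(j < n.+1 | (j <= lift i k)%N) Y i j else 1)
  * \prod_(j < n.+1 | (lift i k <= j < lift i m)%N) X (lift i k) j.
Proof.
set C := \prod_(j < n.+1 | _) Y i j.
rewrite [in RHS](prod_ord_lift i) leq_lift_pivot ltn_pivot_lift.
under [in RHS]eq_bigl => l do rewrite leq_lift2 ltn_lift2.
transitivity ((\prod_(l < n | (k <= l < m)%N)
    if l.+1 == i :> nat then C * X (lift i k) i else 1)
    * \prod_(l < n | (k <= l < m)%N) X (lift i k) (lift i l)).
  rewrite -big_split /=; apply: eq_bigr => l /andP[le_kl _]; rewrite mxE.
  case: eqP => [def_i | _] /=; last by rewrite mul1r.
  have lt_ki : (k < i)%N by rewrite -def_i ltnS.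
  by rewrite ltn_lift_pivot lt_ki mulrAC.
rewrite mulrA; congr (_ * _).
have -> : (if (k < i <= m)%N then C else 1)
    * (if (k < i <= m)%N then X (lift i k) i else 1)
  = if (k < i <= m)%N then C * X (lift i k) i else 1.
  by case: ifP; rewrite ?mulr1.
(* For [i = 0] no column is merged, and [k < i] fails as well. *)
case def_i: (nat_of_ord i) => [|v]; first by rewrite big1.
under eq_bigr => l _ do rewrite eqSS.
rewrite (prod_single_index n (fun l => k <= l < m)%N) /= ltnS.
by rewrite -ltnS -def_i ltn_ord.
Qed.

End Products.

Theorem corollary1 (R : comPzRingType) (n : nat) (t q : R)
    (X Y : 'M[R]_n.+1) :
  P1324 t q X Y =
  \sum_(i < n.+1)
     q ^+ i * (\prod_(j < n.+1 | (i <= j < n)%N) X i j ^+ (n - j))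
     * P1324 t q (R2 X Y i) (R1 t Y i).
Proof.
rewrite P1324_prod sum_by_first_letter; apply: eq_bigr => i _.
rewrite P1324_prod big_distrr; apply: eq_bigr => s _ /=.
rewrite prod_inv_first prod_1324_first prod_asc_first prod_213_first.
rewrite prod_x_first.
rewrite (eq_prod_asc s (prod_R2 X Y i)).
rewrite (eq_prod_213 s (prod_R1 t Y i)).
rewrite prod_ascM prod_213M.
by rewrite [LHS](AC (2*((2*2)*2)) ((1*5)*(2*((4*(7*6))*(3*8)))))%AC.
Qed.
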